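(* Let $X$ and $Y$ be topological spaces and let $f:X\to Y$ be a surjective $*$-continuous map. If $X$ is connected, then $Y$ is connected.
   Context: For a topological space $X$, a set $U\subseteq X$ is called regular open if $\mathrm{int}(\mathrm{cl}(U))=U$. A set $A\subseteq X$ is called $*$-open if for every $x\in A$ there exists a regular open set $U$ of $X$ with $x\in U\subseteq A$. A function $f:X\to Y$ is called $*$-continuous if the inverse image of every $*$-open subset of $Y$ is a $*$-open subset of $X$. *)

(* Defs.v *)
From mathcomp Require Import all_boot.
From mathcomp Require Import classical_sets functions topology.

Set Implicit Arguments.
Unset Strict Implicit.
Unset Printing Implicit Defensive.

Local Open Scope classical_set_scope.

Definition star_open (X : topologicalType) (A : set X) : Prop :=
  forall x : X, A x -> exists U : set X, [/\ regopen U, U x & U `<=` A].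

Definition star_continuous (X Y : topologicalType) (f : X -> Y) : Prop :=
  forall B : set Y, star_open B -> star_open (f @^-1` B).

(* Main.v *)
Require Import Defs.
From mathcomp Require Import all_boot.
From mathcomp Require Import classical_sets functions topology.

(** A clopen set and its complement are regular open, hence star-open, and
    star-open sets are open; so the preimage of a clopen set under a
    star-continuous map is clopen. *)

Local Open Scope classical_set_scope.

(** Connectedness means that a nonempty clopen set is the whole space. A nonempty clopen [B] in [Y]
    has a clopen preimage by [star_continuous_preimage_clopen], nonempty by surjectivity, hence
    equal to [X]; surjectivity again forces [B] to be all of [Y]. *)

Lemma star_open_open (X : topologicalType) (A : set X) : star_open A -> open A.
Proof.
move=> sA; rewrite openE => x /sA[U [Ureg Ux UA]].
(* [Ureg] is the equation int(cl U) = U, which exhibits [U] as an interior. *)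
have Uopen : open U by rewrite -Ureg; exact: open_interior.
by apply: (interiorS UA); move/interior_id: Uopen => ->.
Qed.

Lemma clopen_regopen (X : topologicalType) (A : set X) : clopen A -> regopen A.
Proof. by case=> /interior_id Ao /closure_id Ac; rewrite /regopen -Ac. Qed.

Lemma regopen_star_open (X : topologicalType) (A : set X) :
  regopen A -> star_open A.
Proof. by move=> Areg x Ax; exists A; split. Qed.

Lemma star_continuous_preimage_clopen (X Y : topologicalType) (f : X -> Y)
    (B : set Y) :
  star_continuous f -> clopen B -> clopen (f @^-1` B).
Proof.
move=> fc Bco; have preim_open C : clopen C -> open (f @^-1` C).
  by move=> /clopen_regopen/regopen_star_open/fc/star_open_open.
split; first exact: preim_open.
(* The complement of [B] is clopen too, so its preimage is open. *)
by rewrite -openC preimage_setC; apply/preim_open/clopenC.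
Qed.

Theorem lemma27 (X Y : topologicalType) (f : X -> Y)
  (f_surj : set_surj [set: X] [set: Y] f)
  (f_cont : star_continuous f)
  (X_conn : connected [set: X]) :
  connected [set: Y].
Proof.
(* [B] is the trace on the whole space of an open [C] and of a closed [D], hence equal to both. *)
move=> B [y By] [C Co BC] [D Dc BD]; rewrite setTI in BC; rewrite setTI in BD.
have [fBo fBc] : clopen (f @^-1` B).
  by apply: star_continuous_preimage_clopen => //; split; [rewrite BC|rewrite BD].
have fBT : f @^-1` B = [set: X].
  apply: X_conn.
  - by have [x _ fxy] := f_surj y I; exists x; rewrite /preimage/= fxy.
  - by exists (f @^-1` B); rewrite ?setTI.
  - by exists (f @^-1` B); rewrite ?setTI.
apply/seteqP; split=> // z _; have [x _ <-] := f_surj z I.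
by have : [set: X] x by []; rewrite -fBT.
Qed.
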